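(* Let $\mathbb{F}$ be a non-archimedean real closed field of finite rank extending $\mathbb{R}$, with a surjective real valuation $\bar v:\mathbb{F}^*\to\mathbb{R}$ whose valuation ring is convex; let $\mathbb{K}=\mathbb{F}[i]$ with the extended valuation $\bar v:\mathbb{K}^*\to\mathbb{R}$, and let $\tau=-\bar v$. Let $A\in GL_{n+1}(\mathbb{K})$, acting on $FP^n(\mathbb{K})$, and let $l(A)=\inf_{x\in FP^n(\mathbb{K})}d(x,Ax)$. Let $\lambda_1,\dots,\lambda_{n+1}\in\mathbb{K}$ be the eigenvalues of $A$, ordered so that $|\lambda_i|\ge|\lambda_{i+1}|$. Then the infimum in the definition of $l(A)$ is a minimum, and $$l(A)=\tau\left(\left|\frac{\lambda_1}{\lambda_{n+1}}\right|\right).$$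
   Context: ''Finite rank'' is meant in the sense of ordered fields: the value group of the natural valuation of $\mathbb{F}$ has finitely many convex subgroups. $\mathbb{K}=\mathbb{F}[i]$ ($i^2=-1$) is algebraically closed and extends $\mathbb{C}$; $|\cdot|:\mathbb{K}\to\mathbb{F}_{\ge0}$ is $|a+bi|=\sqrt{a^2+b^2}$, and the extended valuation satisfies $\bar v(z)=\bar v(|z|)$. Eigenvalues are listed with multiplicity. Let $\mathcal{O}=\{z\in\mathbb{K}:\tau(z)\le0\}$ be the valuation ring of $\mathbb{K}$ ($\tau(0)=-\infty$). A maximal $\mathcal{O}$-lattice of $\mathbb{K}^{n+1}$ is a finitely generated $\mathcal{O}$-submodule of rank $n+1$ (equivalently, a free $\mathcal{O}$-module spanned by a $\mathbb{K}$-basis of $\mathbb{K}^{n+1}$). $FP^n(\mathbb{K})$ is the set of maximal $\mathcal{O}$-lattices modulo $L\sim zL$, $z\in\mathbb{K}^*$; $GL_{n+1}(\mathbb{K})$ acts on it by $L\mapsto A(L)$. The canonical metric $d$ on $FP^n(\mathbb{K})$ is: for $x,y$ with lifts $L,L'$, choose an $\mathcal{O}$-basis $v_1,\dots,v_{n+1}$ of $L$ and scalars $a_i\in\mathbb{K}^*$ such that $a_1v_1,\dots,a_{n+1}v_{n+1}$ is an $\mathcal{O}$-basis of $L'$ (this is always possible); then $d(x,y)=\max_i\tau(a_i)-\min_i\tau(a_i)$ (independent of choices). *)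

(* Defs.v *)
From HB Require Import structures.
From mathcomp Require Import all_boot all_order all_algebra.
From mathcomp Require Import boolp classical_sets cardinality reals.
From mathcomp Require Export complex.

Set Implicit Arguments.
Unset Strict Implicit.
Unset Printing Implicit Defensive.

Import Order.TTheory GRing.Theory Num.Theory.

Local Open Scope ring_scope.
Local Open Scope quotient_scope.
Local Open Scope classical_set_scope.
Local Open Scope complex_scope.

(* the modulus with values in F, whereas `|z| takes its values in F[i] *)
Notation cabs := Normc.normc.

Section NaturalValuation.
Variable F : rcfType.

(* The natural valuation of F is the one whose valuation ring consists of the
   finite elements; its value group is F^* modulo the units of that ring,
   written additively. *)
Definition finite_elt (x : F) : Prop := exists n : nat, `|x| <= n%:R.

Lemma finite_elt1 : finite_elt 1.
Proof. by exists 1%N; rewrite normr1. Qed.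

Lemma finite_eltM (x y : F) :
  finite_elt x -> finite_elt y -> finite_elt (x * y).
Proof.
move=> [m xm] [n yn]; exists (m * n)%N.
by rewrite normrM natrM ler_pM.
Qed.

Definition nonzero := {x : F | x != 0}.

Definition nz_mul (x y : nonzero) : nonzero :=
  Sub (val x * val y) (mulf_neq0 (valP x) (valP y)).

Lemma nz_inv_subproof (x : nonzero) : (val x)^-1 != 0.
Proof. by rewrite invr_eq0 (valP x). Qed.

Definition nz_inv (x : nonzero) : nonzero := Sub (val x)^-1 (nz_inv_subproof x).

Definition nz_one : nonzero := Sub 1 (oner_neq0 F).

Definition same_value (x y : nonzero) : bool :=
  `[< finite_elt (val x / val y) /\ finite_elt (val y / val x) >].

Lemma finite_elt_trans (x y z : nonzero) :
  finite_elt (val x / val y) -> finite_elt (val y / val z) ->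
  finite_elt (val x / val z).
Proof.
move=> xy yz; have := finite_eltM xy yz.
by rewrite mulrA divfK ?(valP y).
Qed.

Lemma same_value_refl : reflexive same_value.
Proof.
move=> x; apply/asboolP.
by rewrite divff ?(valP x)//; split; exact: finite_elt1.
Qed.

Lemma same_value_sym : symmetric same_value.
Proof. by move=> x y; apply/asboolP/asboolP => -[]. Qed.

Lemma same_value_trans : transitive same_value.
Proof.
move=> y x z /asboolP[xy yx] /asboolP[yz zy]; apply/asboolP.
by split; [exact: finite_elt_trans xy yz|exact: finite_elt_trans zy yx].
Qed.

Canonical same_value_equiv :=
  EquivRel same_value same_value_refl same_value_sym same_value_trans.

Definition value_group := {eq_quot same_value}.
HB.instance Definition _ : EqQuotient _ same_value value_group :=
  EqQuotient.on value_group.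
HB.instance Definition _ := Choice.on value_group.

Definition vg_zero : value_group := \pi_value_group nz_one.
Definition vg_add (g h : value_group) : value_group :=
  \pi_value_group (nz_mul (repr g) (repr h)).
Definition vg_opp (g : value_group) : value_group :=
  \pi_value_group (nz_inv (repr g)).

(* v(x) <= v(y) iff y / x lies in the valuation ring *)
Definition vg_le (g h : value_group) : Prop :=
  finite_elt (val (repr h) / val (repr g)).

Lemma pi_vgP (x y : nonzero) :
  \pi_value_group x = \pi_value_group y <->
  finite_elt (val x / val y) /\ finite_elt (val y / val x).
Proof.
split=> [/eqmodP/asboolP //|xy]; apply/eqmodP; exact/asboolP.
Qed.

Lemma repr_vgP (x : nonzero) :
  finite_elt (val x / val (repr (\pi_value_group x))) /\
  finite_elt (val (repr (\pi_value_group x)) / val x).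
Proof. by apply/pi_vgP; rewrite reprK. Qed.

Lemma vg_addE (x y : nonzero) :
  vg_add (\pi_value_group x) (\pi_value_group y) =
  \pi_value_group (nz_mul x y).
Proof.
apply/pi_vgP; have [xr rx] := repr_vgP x; have [yr ry] := repr_vgP y.
by split; rewrite /= invfM mulrACA; exact: finite_eltM.
Qed.

Lemma vg_oppE (x : nonzero) :
  vg_opp (\pi_value_group x) = \pi_value_group (nz_inv x).
Proof.
apply/pi_vgP; have [xr rx] := repr_vgP x.
by split; rewrite /= invrK mulrC.
Qed.

Lemma vg_leE (x y : nonzero) :
  vg_le (\pi_value_group x) (\pi_value_group y) <-> finite_elt (val y / val x).
Proof.
have [xr rx] := repr_vgP x; have [yr ry] := repr_vgP y.
rewrite /vg_le; split=> yx.
  exact: finite_elt_trans yr (finite_elt_trans yx rx).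
exact: finite_elt_trans ry (finite_elt_trans yx xr).
Qed.

Lemma vg_addA : associative vg_add.
Proof.
elim/quotW=> x; elim/quotW=> y; elim/quotW=> z.
rewrite (vg_addE y z) (vg_addE x y) (vg_addE x (nz_mul y z)).
rewrite (vg_addE (nz_mul x y) z).
by apply: congr1; apply: val_inj; rewrite /= mulrA.
Qed.

Lemma vg_addC : commutative vg_add.
Proof.
elim/quotW=> x; elim/quotW=> y; rewrite (vg_addE x y) (vg_addE y x).
by apply: congr1; apply: val_inj; rewrite /= mulrC.
Qed.

Lemma vg_add0 : left_id vg_zero vg_add.
Proof.
elim/quotW=> x; rewrite (vg_addE nz_one x).
by apply: congr1; apply: val_inj; rewrite /= mul1r.
Qed.

Lemma vg_addN : left_inverse vg_zero vg_opp vg_add.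
Proof.
elim/quotW=> x; rewrite vg_oppE (vg_addE (nz_inv x) x).
by apply: congr1; apply: val_inj; rewrite /= mulVf ?(valP x).
Qed.

HB.instance Definition _ :=
  GRing.isZmodule.Build value_group vg_addA vg_addC vg_add0 vg_addN.

Definition convex_subgroup (H : set value_group) : Prop :=
  [/\ H 0,
      forall g h, H g -> H h -> H (g - h) &
      forall g h k, H g -> H k -> vg_le g h -> vg_le h k -> H h].

Definition finite_rank : Prop :=
  finite_set [set H : set value_group | convex_subgroup H].

End NaturalValuation.

Section RealValuation.
Variables (R : realType) (F : rcfType).

(* A valuation is defined on F^* only: the value v 0 is never used. *)
Record real_valuation (v : F -> R) : Prop := RealValuation {
  valuationM : forall x y, x != 0 -> y != 0 -> v (x * y) = v x + v y;
  valuationD : forall x y, x != 0 -> y != 0 -> x + y != 0 ->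
    Num.min (v x) (v y) <= v (x + y) }.

Definition surjective_valuation (v : F -> R) : Prop :=
  forall r : R, exists2 x, x != 0 & v x = r.

Definition val_ring (v : F -> R) : set F := [set x | x = 0 \/ 0 <= v x].

Definition convex_valuation (v : F -> R) : Prop :=
  forall x y z, val_ring v x -> val_ring v z -> x <= y -> y <= z ->
    val_ring v y.

Definition ext_val (v : F -> R) (z : F[i]) : R := v (cabs z).

End RealValuation.

Section Lattices.
Variables (R : realType) (F : rcfType) (v : F -> R) (n : nat).

Local Notation K := F[i].
Local Notation V := 'cV[K]_n.+1.

Definition tau (z : K) : R := - ext_val v z.

(* The valuation ring O of K, with the convention tau 0 = -oo; the prefix O_
   below refers to it. *)
Definition val_ringC : set K := [set z | z = 0 \/ tau z <= 0].

Definition O_span k (b : 'I_k -> V) : set V :=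
  [set x | exists2 c : 'I_k -> K, (forall i, val_ringC (c i)) &
                                  x = \sum_i c i *: b i].

Definition O_free k (b : 'I_k -> V) : Prop :=
  forall c : 'I_k -> K, (forall i, val_ringC (c i)) ->
    \sum_i c i *: b i = 0 -> forall i, c i = 0.

Definition O_basis k (b : 'I_k -> V) (L : set V) : Prop :=
  O_free b /\ L = O_span b.

Definition O_fin_gen (L : set V) : Prop :=
  exists k, exists b : 'I_k -> V, L = O_span b.

Definition O_rank (L : set V) (r : nat) : Prop :=
  (exists2 b : 'I_r -> V, (forall i, L (b i)) & O_free b) /\
  (forall k (b : 'I_k -> V), (forall i, L (b i)) -> O_free b -> (k <= r)%N).

Definition is_lattice (L : set V) : Prop := O_fin_gen L /\ O_rank L n.+1.

Record lattice := Lattice { lat_set :> set V; _ : `[< is_lattice lat_set >] }.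
HB.instance Definition _ := [isSub for lat_set].
HB.instance Definition _ := [Choice of lattice by <:].

Definition homothetic (L L' : lattice) : bool :=
  `[< exists2 z : K, z != 0 & (L' : set V) = [set z *: x | x in L] >].

Lemma homothetic_refl : reflexive homothetic.
Proof.
move=> L; apply/asboolP; exists 1; first exact: oner_neq0.
by under eq_imagel do rewrite scale1r; rewrite image_id.
Qed.

Lemma homothetic_trans : transitive homothetic.
Proof.
move=> M L N /asboolP[z z0 Mz] /asboolP[t t0 Nt]; apply/asboolP.
exists (t * z); first exact: mulf_neq0.
by rewrite Nt Mz image_comp; apply: eq_imagel => x _ /=; rewrite scalerA.
Qed.

Lemma homothetic_sym : symmetric homothetic.
Proof.
suff sym L M : homothetic L M -> homothetic M L.
  by move=> L M; apply/idP/idP; exact: sym.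
move=> /asboolP[z z0 Mz]; apply/asboolP.
exists z^-1; first by rewrite invr_eq0.
rewrite Mz image_comp -[LHS]image_id; apply: eq_imagel => x _ /=.
by rewrite scalerA mulVf// scale1r.
Qed.

Canonical homothetic_equiv :=
  EquivRel homothetic homothetic_refl homothetic_sym homothetic_trans.

Definition FP := {eq_quot homothetic}.
HB.instance Definition _ : EqQuotient _ homothetic FP := EqQuotient.on FP.
HB.instance Definition _ := Choice.on FP.

Section Action.
Variables (A : 'M[K]_n.+1) (hA : A \in unitmx).

Lemma O_span_mul k (b : 'I_k -> V) :
  [set A *m x | x in O_span b] = O_span (fun i => A *m b i).
Proof.
have E (c : 'I_k -> K) :
    A *m (\sum_i c i *: b i) = \sum_i c i *: (A *m b i).
  by rewrite mulmx_sumr; apply: eq_bigr => i _; rewrite scalemxAr.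
apply/seteqP; split=> x.
  by move=> [_ [c Oc ->] <-]; exists c.
by move=> [c Oc ->]; exists (\sum_i c i *: b i) => //; exists c.
Qed.

Lemma O_free_mul k (b : 'I_k -> V) :
  O_free (fun i => A *m b i) <-> O_free b.
Proof.
have E (c : 'I_k -> K) :
    \sum_i c i *: (A *m b i) = A *m (\sum_i c i *: b i).
  by rewrite mulmx_sumr; apply: eq_bigr => i _; rewrite scalemxAr.
split=> fb c Oc; last first.
  rewrite E => /(congr1 (mulmx (invmx A))).
  by rewrite mulKmx// mulmx0; exact: fb.
by move=> c0; apply: fb => //; rewrite E c0 mulmx0.
Qed.

Lemma is_lattice_mul (L : lattice) : is_lattice [set A *m x | x in L].
Proof.
case: L => L /= /asboolP[[k [b Lb]] [[e Le fe] mx]]; split.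
  by exists k, (fun i => A *m b i); rewrite Lb O_span_mul.
split.
  by exists (fun i => A *m e i); [move=> i; exists (e i)|exact/O_free_mul].
move=> m c Lc fc; apply: (mx m (fun i => invmx A *m c i)) => [i|].
  by have [x Lx <-] := Lc i; rewrite mulKmx.
apply/O_free_mul; congr O_free: fc; apply: funext => i.
by rewrite mulKVmx.
Qed.

Definition lat_act (L : lattice) : lattice :=
  Lattice (asboolT (is_lattice_mul L)).

Definition FPact (x : FP) : FP := \pi_FP (lat_act (repr x)).

Lemma FPactE (L : lattice) : FPact (\pi_FP L) = \pi_FP (lat_act L).
Proof.
apply/eqmodP/asboolP.
have /eqmodP/asboolP[z z0 Lz] : \pi_FP (repr (\pi_FP L)) = \pi_FP L.
  exact: reprK.
exists z => //=; rewrite Lz !image_comp; apply: eq_imagel => x _ /=.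
by rewrite scalemxAr.
Qed.

End Action.

Definition is_FPdist (x y : FP) (r : R) : Prop :=
  exists L L' : lattice, [/\ \pi_FP L = x, \pi_FP L' = y &
    exists (b : 'I_n.+1 -> V) (a : 'I_n.+1 -> K),
      [/\ O_basis b L, forall i, a i != 0,
          O_basis (fun i => a i *: b i) L' &
          r = (\big[Num.max/tau (a ord0)]_i tau (a i))
              - (\big[Num.min/tau (a ord0)]_i tau (a i))]].

(* The real number singled out by is_FPdist, whose existence and independence
   of the choices are facts about lattices over a valuation ring. *)
Definition FPdist (x y : FP) : R := xget 0 [set r | is_FPdist x y r].

Definition transl_length (A : 'M[K]_n.+1) (hA : A \in unitmx) : R :=
  inf [set FPdist x (FPact hA x) | x in [set: FP]].

End Lattices.

(* Main.v *)
(* Write a basis of a lattice as the columns of an invertible matrix B, unique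
   up to GL(O) on the right.  By the Smith form over the valuation ring O, one
   may choose B with B^-1 A B = diag(a) W and W in GL(O), and d(x, Ax) is then
   the spread of the tau (a i).  If y is a left eigenvector of A for lam, then
   u = y B satisfies u diag(a) = lam u W^-1: comparing the coordinates where u
   has maximal value gives tau (a j) <= tau lam for some j, and those where
   u diag(a) has maximal value gives tau lam <= tau (a i) for some i.  Hence
   d(x, Ax) >= tau lam - tau mu for all eigenvalues lam and mu.  Equality is
   attained at the lattice of a suitably rescaled basis in which A is triangular
   with negligible off-diagonal entries, so that a lists the eigenvalues. *)
Require Import Defs.
From HB Require Import structures.
From mathcomp Require Import all_boot all_order all_algebra.
From mathcomp Require Import perm spectral.
From mathcomp Require Import boolp classical_sets cardinality reals.

Set Implicit Arguments.
Unset Strict Implicit.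
Unset Printing Implicit Defensive.

Import Order.TTheory GRing.Theory Num.Theory.
Local Open Scope ring_scope.
Local Open Scope classical_set_scope.
Local Open Scope complex_scope.

(** * The valuation on [F], its extension to [F[i]] and the valuation ring [O] *)

Section Valuation.
Variables (R : realType) (F : rcfType) (v : F -> R).
Hypotheses (hv : real_valuation v) (hconv : convex_valuation v).

Local Notation K := F[i].
Local Notation tau := (tau v).
Local Notation O := (val_ringC v).

Lemma valuation1 : v 1 = 0.
Proof.
have := valuationM hv (oner_neq0 _) (oner_neq0 _).
by rewrite mulr1 => /eqP; rewrite -{1}[v 1]addr0 => /eqP/addrI.
Qed.

Lemma valuationV x : x != 0 -> v x^-1 = - v x.
Proof.
move=> x0; have := valuationM hv (y := x^-1) x0.
rewrite invr_eq0 divff// valuation1 => /(_ x0) /esym/eqP.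
by rewrite addrC addr_eq0 => /eqP.
Qed.

(** Convexity enters here: [x / y] lies between 0 and 1, both in the valuation ring, hence has
    nonnegative valuation. *)
Lemma le_valuation x y : 0 < x -> x <= y -> v y <= v x.
Proof.
move=> x0 xy; have y0 : 0 < y by exact: lt_le_trans xy.
have : val_ring v (x / y).
  apply: (hconv (x := 0) (z := 1)); first by left.
  - by right; rewrite valuation1.
  - by rewrite divr_ge0// ltW.
  - by rewrite ler_pdivrMr// mul1r.
case=> [/eqP|]; first by rewrite mulf_eq0 invr_eq0 !gt_eqF.
rewrite (valuationM hv) ?invr_eq0 ?gt_eqF// valuationV ?gt_eqF//.
by rewrite subr_ge0.
Qed.

Lemma normc_gt0 (z : K) : z != 0 -> 0 < cabs z.
Proof.
move=> z0; rewrite lt_neqAle eq_sym; apply/andP; split.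
  by apply: contra z0 => /eqP/Normc.eq0_normc ->.
by case: z z0 => a b _; rewrite sqrtr_ge0.
Qed.

Lemma tauM z w : z != 0 -> w != 0 -> tau (z * w) = tau z + tau w.
Proof.
move=> z0 w0; rewrite /Defs.tau /ext_val Normc.normcM (valuationM hv) ?opprD//;
  by rewrite gt_eqF// normc_gt0.
Qed.

Lemma tauV z : z != 0 -> tau z^-1 = - tau z.
Proof.
move=> z0; rewrite /Defs.tau /ext_val Normc.normcV valuationV//.
by rewrite gt_eqF// normc_gt0.
Qed.

Lemma le_tau z w : z != 0 -> cabs z <= cabs w -> tau z <= tau w.
Proof. by move=> z0 zw; rewrite lerN2 le_valuation// normc_gt0. Qed.

Lemma O0 : O 0. Proof. by left. Qed.

Lemma O1 : O 1.
Proof. by right; rewrite /Defs.tau /ext_val Normc.normc1 valuation1 oppr0. Qed.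

Lemma ON z : O z -> O (- z).
Proof.
case=> [->|z0]; first by left; rewrite oppr0.
by right; rewrite /Defs.tau /ext_val normcN.
Qed.

(** The triangle inequality for the modulus, with monotonicity of [v], reduces the claim to the
    ultrametric inequality in [F] for [cabs z + cabs w], which is nonzero as a sum of positive
    elements. *)
Lemma OD z w : O z -> O w -> O (z + w).
Proof.
have [->|z0] := eqVneq z 0; first by rewrite add0r.
have [->|w0] := eqVneq w 0; first by rewrite addr0.
have [->|zw0] := eqVneq (z + w) 0; first by left.
case=> [/eqP|Oz]; first by rewrite (negbTE z0).
case=> [/eqP|Ow]; first by rewrite (negbTE w0).
right; move: Oz Ow; rewrite /Defs.tau /ext_val !oppr_le0 => Oz Ow.
have zn := normc_gt0 z0; have wn := normc_gt0 w0.
apply: (@le_trans _ _ (v (cabs z + cabs w))); last first.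
  by apply: le_valuation; [exact: normc_gt0|exact: le_normcD].
apply: le_trans (valuationD hv _ _ _); rewrite ?gt_eqF ?addr_gt0//.
by rewrite le_min Oz.
Qed.

Lemma OM z w : O z -> O w -> O (z * w).
Proof.
have [->|z0] := eqVneq z 0; first by rewrite mul0r.
have [->|w0] := eqVneq w 0; first by rewrite mulr0.
case=> [/eqP|Oz]; first by rewrite (negbTE z0).
case=> [/eqP|Ow]; first by rewrite (negbTE w0).
by right; rewrite tauM// -[0]addr0 lerD.
Qed.

Lemma O_sum (I : Type) (r : seq I) (P : pred I) (f : I -> K) :
  (forall i, O (f i)) -> O (\sum_(i <- r | P i) f i).
Proof. by move=> Of; elim/big_ind: _ => // [|? ?]; [exact: O0|exact: OD]. Qed.

Lemma O_prod (I : Type) (r : seq I) (P : pred I) (f : I -> K) :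
  (forall i, O (f i)) -> O (\prod_(i <- r | P i) f i).
Proof. by move=> Of; elim/big_ind: _ => // [|? ?]; [exact: O1|exact: OM]. Qed.

Lemma O_divP z w : z != 0 -> w != 0 -> O (z / w) <-> tau z <= tau w.
Proof.
move=> z0 w0; rewrite /val_ringC /= tauM ?invr_eq0// tauV// subr_le0.
split=> [[/eqP|//]|]; last by right.
by rewrite mulf_eq0 invr_eq0 (negbTE z0) (negbTE w0).
Qed.

(** An entry of largest modulus for the order of [F] also has largest [tau], so dividing by it puts
    the whole family in [O]. This is the normalisation behind every later elimination and
    estimate. *)
Lemma O_max (I : finType) (c : I -> K) : (exists i, c i != 0) ->
  exists2 i, c i != 0 & forall j, O (c j / c i).
Proof.
case=> i0 ci0.
have := @Order.TotalTheory.arg_maxP _ _ _ i0 predT (fun i => cabs (c i)).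
case=> //.
move=> i _ imax.
have ci : c i != 0.
  apply: contraTN (imax i0 isT) => /eqP /= ->.
  by rewrite Normc.normc0 -ltNge normc_gt0.
exists i => // j; have [->|cj] := eqVneq (c j) 0.
  by rewrite mul0r; exact: O0.
by apply/O_divP => //; apply: le_tau => //; exact: imax.
Qed.

Lemma O_max_col k (c : 'cV[K]_k) : c != 0 ->
  exists2 i, c i 0 != 0 & forall j, O (c j 0 / c i 0).
Proof.
move=> c0; apply: (O_max (c := fun i => c i 0)); apply/not_existsP => c00.
move/eqP: c0; apply; apply/matrixP => i j.
by rewrite mxE ord1; apply/eqP; apply: contra_notT (c00 i).
Qed.

(** * Matrices over [O], the group GL(O) and the Smith form *)

Definition Omx m n (M : 'M[K]_(m, n)) := forall i j, O (M i j).

Lemma Omx_mul m n p (M : 'M_(m, n)) (N : 'M_(n, p)) :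
  Omx M -> Omx N -> Omx (M *m N).
Proof. by move=> OMM ONN i j; rewrite mxE; apply: O_sum => k; exact: OM. Qed.

Lemma O_nat n : O n%:R.
Proof.
by elim: n => [|n IH]; [exact: O0|rewrite mulrS; apply: OD => //; exact: O1].
Qed.

Lemma O_sign n : O ((-1) ^+ n).
Proof.
elim: n => [|n IH]; first exact: O1.
by rewrite exprS; apply: OM => //; apply: ON; exact: O1.
Qed.

Lemma Omx0 m n : Omx (0 : 'M_(m, n)).
Proof. by move=> i j; rewrite mxE; exact: O0. Qed.

Lemma Omx1 n : Omx (1%:M : 'M_n).
Proof. by move=> i j; rewrite mxE; exact: O_nat. Qed.

Lemma Omx_block m1 m2 n1 n2 (M1 : 'M_(m1, n1)) (M2 : 'M_(m1, n2))
    (M3 : 'M_(m2, n1)) (M4 : 'M_(m2, n2)) :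
  Omx M1 -> Omx M2 -> Omx M3 -> Omx M4 -> Omx (block_mx M1 M2 M3 M4).
Proof.
move=> O1 O2 O3 O4 i j.
by rewrite !mxE; case: split => k; rewrite mxE; case: split.
Qed.

Lemma O_det n (M : 'M_n) : Omx M -> O (\det M).
Proof.
move=> OMM; apply: O_sum => s; apply: OM; first exact: O_sign.
exact: O_prod.
Qed.

(** The group GL(O), described by a determinant that is a unit of [O]. *)
Definition GLO n (M : 'M[K]_n) := [/\ Omx M, \det M != 0 & O (\det M)^-1].

Lemma GLO_unitmx n (M : 'M_n) : GLO M -> M \in unitmx.
Proof. by case=> _ d0 _; rewrite unitmxE unitfE. Qed.

Lemma GLO_det1 n (M : 'M_n) : Omx M -> \det M = 1 -> GLO M.
Proof.
by move=> OMM d1; split; rewrite // d1 ?oner_neq0// invr1; exact: O1.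
Qed.

Lemma GLO1 n : GLO (1%:M : 'M_n).
Proof. by apply: GLO_det1; [exact: Omx1|rewrite det1]. Qed.

Lemma GLO_mul n (M N : 'M_n) : GLO M -> GLO N -> GLO (M *m N).
Proof.
move=> [OMM M0 MV] [ONN N0 NV]; split; first exact: Omx_mul.
- by rewrite det_mulmx mulf_neq0.
- by rewrite det_mulmx invfM; exact: OM.
Qed.

(** The entries of the inverse are signed minors of [M], which lie in [O], times the inverse of the
    determinant. *)
Lemma GLO_inv n (M : 'M_n) : GLO M -> GLO (invmx M).
Proof.
move=> GM; have [OMM M0 MV] := GM; split.
- move=> i j; rewrite /invmx GLO_unitmx// !mxE; apply: OM => //.
  apply: OM; first exact: O_sign.
  by apply: O_det => k l; rewrite !mxE.
- by rewrite det_inv invr_eq0.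
- by rewrite det_inv invrK; exact: O_det.
Qed.

Lemma GLO_tperm n (i j : 'I_n) : GLO (tperm_mx i j : 'M_n).
Proof.
split; first by move=> k l; rewrite !mxE; exact: O_nat.
  by rewrite det_perm signr_eq0.
by rewrite det_perm -signr_odd invr_sign; exact: O_sign.
Qed.

(* M = U^-1 D W^-1: pivoting on an entry of maximal value keeps the elimination
   coefficients in the valuation ring. *)
Lemma Smith_form m (M : 'M[K]_m) :
  exists U W (d : 'rV_m), [/\ GLO U, GLO W & U *m M *m W = diag_mx d].
Proof.
elim: m M => [|m IH] M.
  exists 1%:M, 1%:M, 0; split; [exact: GLO1|exact: GLO1|].
  by apply/matrixP => -[].
have [->|M0] := eqVneq M 0.
  exists 1%:M, 1%:M, 0; split; [exact: GLO1|exact: GLO1|].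
  by rewrite mulmx0 mul0mx; apply/matrixP => i j; rewrite !mxE mul0rn.
have [p Mp Opmax] : exists2 p : 'I_m.+1 * 'I_m.+1, M p.1 p.2 != 0 &
    forall q : 'I_m.+1 * 'I_m.+1, O (M q.1 q.2 / M p.1 p.2).
  apply: (O_max (c := fun p : 'I_m.+1 * 'I_m.+1 => M p.1 p.2)).
  apply/not_existsP => M00; move/eqP: M0; apply; apply/matrixP => i j.
  by rewrite mxE; apply/eqP; apply: contra_notT (M00 (i, j)).
(* Transpositions bring the pivot [a] to the top left corner. *)
pose N : 'M_(1 + m) := xrow 0 p.1 (xcol 0 p.2 M).
pose a := M p.1 p.2.
have ulN : ulsubmx N = a%:M.
  rewrite [LHS]mx11_scalar; congr (_%:M).
  by rewrite !mxE !lshift0 !tpermL.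
have ONa i j : O (N i j / a) by rewrite !mxE; exact: (Opmax (_, _)).
have Our : Omx (- a^-1 *: ursubmx N).
  by move=> i j; rewrite 3!mxE mulNr mulrC; apply: ON; exact: ONa.
have Odl : Omx (- a^-1 *: dlsubmx N).
  by move=> i j; rewrite 3!mxE mulNr mulrC; apply: ON; exact: ONa.
(* The induction runs on the Schur complement of [a], the block left once [E1] and [E2] have cleared
   the first column and row. *)
have [U [W [d [GU GW UMW]]]] :=
  IH (drsubmx N - a^-1 *: (dlsubmx N *m ursubmx N)).
pose E1 : 'M_(1 + m) := block_mx 1%:M 0 (- a^-1 *: dlsubmx N) 1%:M.
pose E2 : 'M_(1 + m) := block_mx 1%:M (- a^-1 *: ursubmx N) 0 1%:M.
have GE1 : GLO E1.
  apply: GLO_det1; last by rewrite det_lblock !det1 mulr1.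
  by apply: Omx_block => //; [exact: Omx1|exact: Omx0|exact: Omx1].
have GE2 : GLO E2.
  apply: GLO_det1; last by rewrite det_ublock !det1 mulr1.
  by apply: Omx_block => //; [exact: Omx1|exact: Omx0|exact: Omx1].
have Gblock (X : 'M_m) : GLO X -> GLO (block_mx 1%:M 0 0 X : 'M_(1 + m)).
  case=> OX X0 XV; split; last 2 first.
  - by rewrite det_ublock det1 mul1r.
  - by rewrite det_ublock det1 mul1r.
  by apply: Omx_block => //; [exact: Omx1|exact: Omx0|exact: Omx0].
have EN : E1 *m N *m E2 =
    block_mx a%:M 0 0 (drsubmx N - a^-1 *: (dlsubmx N *m ursubmx N)).
  have dl0 : - a^-1 *: dlsubmx N *m a%:M + dlsubmx N = 0.
    by rewrite mul_mx_scalar scalerA mulrN divff// scaleN1r addNr.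
  have ur0 : a%:M *m (- a^-1 *: ursubmx N) + ursubmx N = 0.
    by rewrite mul_scalar_mx scalerA mulrN divff// scaleN1r addNr.
  rewrite -[N in LHS]submxK ulN !mulmx_block !mul1mx !mulmx1 !mul0mx !mulmx0.
  rewrite !addr0.
  by rewrite dl0 ur0 mul0mx add0r -scalemxAl scaleNr addrC.
exists ((block_mx 1%:M 0 0 U : 'M_(1 + m)) *m E1 *m tperm_mx 0 p.1).
exists (tperm_mx 0 p.2 *m E2 *m (block_mx 1%:M 0 0 W : 'M_(1 + m))).
exists (row_mx (const_mx a) d : 'rV_(1 + m)); split.
- by do 2?apply: GLO_mul; [exact: Gblock| |exact: GLO_tperm].
- by do 2?apply: GLO_mul; [exact: GLO_tperm| |exact: Gblock].
have -> (X1 X2 Y1 Y2 : 'M[K]_m.+1) :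
    X1 *m E1 *m X2 *m M *m (Y1 *m E2 *m Y2) =
    X1 *m (E1 *m (X2 *m (M *m Y1)) *m E2) *m Y2 by rewrite !mulmxA.
rewrite -xcolE -xrowE EN; set X := block_mx a%:M _ _ _.
transitivity (block_mx 1%:M 0 0 U *m X *m block_mx 1%:M 0 0 W) => //.
rewrite !mulmx_block !mul1mx !mulmx1 !mul0mx !mulmx0.
rewrite !addr0 !add0r UMW; rewrite [RHS](@diag_mx_row _ m 1).
have -> : diag_mx (const_mx a : 'rV_1) = a%:M.
  by apply/matrixP => i j; rewrite !mxE.
by rewrite mul0mx.
Qed.


(** * Lattices as [O]-spans of the columns of matrices *)

Section Lattice.
Local Open Scope quotient_scope.
Variable n : nat.
Local Notation V := 'cV[K]_n.+1.
Local Notation span := (O_span v).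

Definition colf k (B : 'M[K]_(n.+1, k)) : 'I_k -> V := fun j => col j B.

Lemma colf_surj k (b : 'I_k -> V) : exists B, b = colf B.
Proof.
exists (\matrix_(i, j) b j i 0); apply: funext => j.
by apply/matrixP => i l; rewrite !mxE ord1.
Qed.

Lemma sum_colf k (B : 'M_(n.+1, k)) (c : 'I_k -> K) :
  \sum_i c i *: colf B i = B *m (\col_i c i).
Proof.
apply/matrixP => i j; rewrite summxE !mxE; apply: eq_bigr => l _.
by rewrite !mxE mulrC.
Qed.

Lemma O_span_colfP k (B : 'M_(n.+1, k)) x :
  span (colf B) x <-> exists2 c : 'cV_k, Omx c & x = B *m c.
Proof.
split=> [[c Oc ->]|[c Oc ->]].
  by exists (\col_i c i); rewrite ?sum_colf// => i j; rewrite mxE.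
exists (fun i => c i 0) => [i|]; first exact: Oc.
by rewrite sum_colf; congr (_ *m _); apply/matrixP => i j; rewrite mxE ord1.
Qed.

Lemma colf_span k (B : 'M_(n.+1, k)) j : span (colf B) (colf B j).
Proof.
by apply/O_span_colfP; exists (col j 1%:M) => [i l|];
  [rewrite mxE; exact: Omx1|rewrite /colf !colE mulmxA mulmx1].
Qed.

(** Turns containment of spans into a matrix factorisation: the coordinate vectors of the columns of
    [C] are assembled into [U]. *)
Lemma sub_O_span k l (B : 'M_(n.+1, k)) (C : 'M_(n.+1, l)) :
  (forall j, span (colf B) (colf C j)) <-> exists2 U, Omx U & C = B *m U.
Proof.
split=> [BC|[U OU -> j]]; last first.
  apply/O_span_colfP; exists (col j U) => [i k'|].
    by rewrite mxE; exact: OU.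
  by rewrite /colf !colE mulmxA.
have /choice[c cP] j : exists c : 'cV_k, Omx c /\ colf C j = B *m c.
  by have /O_span_colfP[c] := BC j; exists c.
exists (\matrix_(i, j) c j i 0) => [i j|].
  by rewrite mxE; case: (cP j) => + _; apply.
apply/matrixP => i j; have [_ /matrixP/(_ i 0)] := cP j; rewrite !mxE => ->.
by apply: eq_bigr => r _; rewrite !mxE.
Qed.

Lemma O_span_sub k l (B : 'M_(n.+1, k)) (U : 'M_(k, l)) :
  Omx U -> span (colf (B *m U)) `<=` span (colf B).
Proof.
move=> OU x /O_span_colfP[c Oc ->]; apply/O_span_colfP.
by exists (U *m c); [exact: Omx_mul|rewrite mulmxA].
Qed.

Lemma O_span_GLO k (B : 'M_(n.+1, k)) (U : 'M_k) :
  GLO U -> span (colf (B *m U)) = span (colf B).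
Proof.
move=> GU; have [OU _ _] := GU; have [OV _ _] := GLO_inv GU.
apply/seteqP; split; first exact: O_span_sub.
have := @O_span_sub _ _ (B *m U) _ OV.
by rewrite -mulmxA mulmxV ?mulmx1//; exact: GLO_unitmx.
Qed.

(* clearing denominators *)
Lemma O_free_colfP k (B : 'M_(n.+1, k)) :
  O_free v (colf B) <-> forall c : 'cV_k, B *m c = 0 -> c = 0.
Proof.
split=> fB c; last first.
  move=> _; rewrite sum_colf => /fB /matrixP c0 i.
  by have := c0 i 0; rewrite !mxE.
move=> Bc; apply/eqP; apply/negP => /negP c0.
(* Divided by its entry [i], the relation has coefficients in [O] and coefficient 1 at [i], against
   freeness. *)
have [i ci Oci] := O_max_col c0.
have /fB /(_ _ i) : forall j, O (c j 0 / c i 0) by [].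
rewrite divff// => /(_ _)/eqP; rewrite oner_eq0 => H; apply: notF; apply: H.
rewrite sum_colf (_ : \col__ _ = (c i 0)^-1 *: c); last first.
  by apply/matrixP => j l; rewrite !mxE ord1 mulrC.
by rewrite -scalemxAr Bc scaler0.
Qed.

Lemma ker0_row_free k (B : 'M[K]_(n.+1, k)) :
  (forall c : 'cV_k, B *m c = 0 -> c = 0) <-> row_free B^T.
Proof.
split=> [B0|fB c Bc].
  apply/inj_row_free => u uB; apply: trmx_inj; rewrite trmx0; apply: B0.
  by apply: trmx_inj; rewrite trmx_mul trmxK uB trmx0.
apply: trmx_inj; apply: (row_free_inj fB).
by rewrite /= trmx0 mul0mx -trmx_mul Bc trmx0.
Qed.

Lemma O_free_le k (b : 'I_k -> V) : O_free v b -> (k <= n.+1)%N.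
Proof.
have [B ->] := colf_surj b => /O_free_colfP/ker0_row_free/eqP <-.
exact: rank_leq_col.
Qed.

Lemma O_free_unitmx (B : 'M_n.+1) : O_free v (colf B) <-> B \in unitmx.
Proof.
by rewrite -unitmx_tr -row_free_unit -ker0_row_free; exact: O_free_colfP.
Qed.

Lemma O_basis_colfP (B : 'M_n.+1) L :
  O_basis v (colf B) L <-> B \in unitmx /\ L = span (colf B).
Proof. by split=> -[/O_free_unitmx]. Qed.

Lemma is_lattice_span (B : 'M_n.+1) :
  B \in unitmx -> is_lattice v (span (colf B)).
Proof.
move=> Bu; split; first by exists n.+1, (colf B).
split; last by move=> k b _; exact: O_free_le.
by exists (colf B) => [j|]; [exact: colf_span|exact/O_free_unitmx].
Qed.

(** A relation whose coefficient at [i0] has maximal value can be solved for column [i0] with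
    coefficients in [O], so this generator is redundant. *)
Lemma O_span_drop k (B : 'M_(n.+1, k.+1)) (c : 'cV_k.+1) (i0 : 'I_k.+1) :
  B *m c = 0 -> c i0 0 != 0 -> (forall j, O (c j 0 / c i0 0)) ->
  span (colf B) = span (colf (col' i0 B)).
Proof.
move=> Bc ci0 Oc; apply/seteqP; split=> x; last first.
  have -> : col' i0 B = B *m (\matrix_(i, j) (i == lift i0 j)%:R).
    apply/matrixP => i j; rewrite !mxE (bigD1 (lift i0 j)) //= !mxE eqxx mulr1.
    by rewrite big1 ?addr0// => l lj; rewrite !mxE (negbTE lj) mulr0.
  by apply: O_span_sub => i j; rewrite mxE; exact: O_nat.
have BE : B = col' i0 B *m \matrix_(i, j)
    (if j == i0 then - (c (lift i0 i) 0 / c i0 0) else (j == lift i0 i)%:R).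
  apply/matrixP => i j; rewrite !mxE; have [->|ji0] := eqVneq j i0.
    have /matrixP/(_ i 0) := Bc; rewrite !mxE (bigD1_ord i0)//= => /eqP.
    rewrite addr_eq0 => /eqP /(canRL (mulfK ci0)) ->.
    rewrite mulNr mulr_suml -sumrN; apply: eq_bigr => l _.
    by rewrite !mxE eqxx mulrN mulrA.
  have [l jE|/eqP] := unliftP i0 j; last by rewrite (negbTE ji0).
  rewrite (bigD1 l) //= !mxE (negbTE ji0) jE eqxx mulr1 big1 ?addr0// => m ml.
  rewrite !mxE -jE (negbTE ji0) jE (inj_eq lift_inj).
  by rewrite eq_sym (negbTE ml) mulr0.
rewrite {1}BE; apply: O_span_sub => i j; rewrite mxE.
by case: ifP => _; [exact: ON|exact: O_nat].
Qed.

(* a generating family of minimal cardinality is free *)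
Lemma lattice_basis L : is_lattice v L ->
  exists2 B : 'M_n.+1, B \in unitmx & L = span (colf B).
Proof.
move=> [[k0 [b0 Lb0]] [[e Le fe] maxL]].
pose gen k := `[< exists B : 'M_(n.+1, k), L = span (colf B) >].
have ex_gen : exists k, gen k.
  exists k0; apply/asboolP.
  by have [B bB] := colf_surj b0; exists B; rewrite -bB.
case: (ex_minnP ex_gen) => k /asboolP[B LB] kmin {ex_gen}.
have fB : O_free v (colf B).
  apply/O_free_colfP => c Bc; apply/eqP; apply/negP => /negP c0.
  have [i ci Oci] := O_max_col c0.
  case: k => [|k] in B LB kmin c Bc c0 i ci Oci *; first by case: (i).
  have /kmin : gen k.
    by apply/asboolP; exists (col' i B); rewrite -(O_span_drop Bc ci).
  by rewrite ltnn.
(* Freeness of [B] gives one inequality; the other holds because the free family [e] of [n.+1]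
   vectors of [L] factors through the [k] columns of [B]. *)
have kn : k = n.+1.
  apply/eqP; rewrite eqn_leq (O_free_le fB)/=.
  have [E eE] := colf_surj e; rewrite eE in fe Le.
  have [U _ EBU] : exists2 U, Omx U & E = B *m U.
    by apply/sub_O_span => j; rewrite -LB.
  move/O_free_unitmx: fe; rewrite -row_free_unit => /eqP <-.
  by rewrite EBU (leq_trans (mxrankM_maxl _ _))// rank_leq_col.
move: B LB fB; rewrite kn => B LB fB.
by exists B => //; exact/O_free_unitmx.
Qed.

(** The two inclusions give matrices [U] and [W] over [O] with [U *m W = 1%:M]; the inverse of
    [\det U] is then [\det W], an element of [O]. *)
Lemma homothety_mx (B C : 'M_n.+1) z : B \in unitmx -> C \in unitmx -> z != 0 ->
  span (colf C) = [set z *: x | x in span (colf B)] ->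
  exists2 U, GLO U & C = z *: (B *m U).
Proof.
move=> Bu Cu z0 CB.
have [U OU CU] : exists2 U, Omx U & z^-1 *: C = B *m U.
  apply/sub_O_span => j; have := colf_span C j; rewrite CB => -[x Bx].
  move=> /(congr1 (fun y => z^-1 *: y)); rewrite scalerA mulVf// scale1r => xE.
  by rewrite /colf linearZ /= -/(colf C j) -xE.
have [W OW BW] : exists2 W, Omx W & z *: B = C *m W.
  apply/sub_O_span => j; rewrite CB; exists (colf B j); first exact: colf_span.
  by rewrite /colf linearZ.
have CE : C = z *: (B *m U) by rewrite -CU scalerA divff// scale1r.
have UW : U *m W = 1%:M.
  rewrite -[LHS](mulKmx Bu) (mulmxA B) -CU -scalemxAl -BW scalerA.
  by rewrite mulVf// scale1r mulVmx.
have U0 : \det U != 0 by have /mulmx1_unit[] := UW; rewrite unitmxE unitfE.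
exists U => //; split=> //.
move/(congr1 determinant): UW; rewrite det_mulmx det1 => UW.
by rewrite -[_^-1]mulr1 -UW mulKf//; exact: O_det.
Qed.

(** * The metric in matrix terms and its independence of choices *)

Definition spread (a : 'I_n.+1 -> K) : R :=
  \big[Num.max/tau (a ord0)]_i tau (a i) -
  \big[Num.min/tau (a ord0)]_i tau (a i).

Lemma spread_ge a i j : tau (a i) - tau (a j) <= spread a.
Proof. by rewrite lerB ?le_bigmax ?bigmin_le. Qed.

(** The iterated maximum and minimum start from [tau (a ord0)], itself one of the values, so
    bounding the pairwise differences is enough. *)
Lemma spread_le a r : (forall i j, tau (a i) - tau (a j) <= r) -> spread a <= r.
Proof.
move=> ar; rewrite lerBlDr.
have ai i : tau (a i) <= r + \big[Num.min/tau (a ord0)]_i tau (a i).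
  by rewrite -lerBlDl le_bigmin// => [|j _]; rewrite lerBlDl -lerBlDr.
exact: bigmax_le.
Qed.

Local Notation diag a := (diag_mx (\row_i a i)).

Lemma colf_diag (B : 'M_n.+1) (a : 'I_n.+1 -> K) :
  (fun j => a j *: colf B j) = colf (B *m diag a).
Proof.
apply: funext => j; apply/matrixP => i l.
by rewrite mul_mx_diag !mxE mulrC.
Qed.

Lemma diag_unitmx (a : 'I_n.+1 -> K) :
  (diag a \in unitmx) = [forall i, a i != 0].
Proof.
rewrite unitmxE unitfE det_diag; apply/prodf_neq0/forallP => [a0 i|a0 i _].
  by have := a0 i isT; rewrite mxE.
by rewrite mxE.
Qed.

Lemma is_FPdistP (x y : FP v n) r : is_FPdist x y r <->
  exists (L L' : lattice v n) (B : 'M_n.+1) (a : 'I_n.+1 -> K),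
    [/\ \pi_(FP v n) L = x /\ \pi_(FP v n) L' = y,
        B \in unitmx /\ (forall i, a i != 0),
        (L : set V) = span (colf B), (L' : set V) = span (colf (B *m diag a)) &
        r = spread a].
Proof.
split=> [[L [L' [Lx Ly [b [a [bL a0 aL ->]]]]]]|].
  have [B bB] := colf_surj b; move: bL aL; rewrite bB colf_diag.
  move=> /O_basis_colfP[Bu LB] /O_basis_colfP[Du LD].
  by exists L, L', B, a; split.
move=> [L [L' [B [a [[Lx Ly] [Bu a0] LB LD ->]]]]]; exists L, L'; split => //.
exists (colf B), a; split => //; first exact/O_basis_colfP.
rewrite colf_diag; apply/O_basis_colfP; split=> //.
by rewrite unitmx_mul Bu diag_unitmx; apply/forallP.
Qed.

(** Take [i] with [a i] of maximal value: dividing the sum by [a i] leaves a sum of elements of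
    [O]. *)
Lemma le_tau_scaled_sum (a u w : 'I_n.+1 -> K) (b c : K) :
  (forall i, a i != 0) -> b != 0 -> c != 0 ->
  (forall i, O (u i)) -> (forall i, O (w i)) ->
  b = c * \sum_i u i * a i * w i -> exists i, tau b <= tau c + tau (a i).
Proof.
move=> a0 b0 c0 Ou Ow bE.
have [|i ai Oa] := O_max (c := a); first by exists ord0.
exists i; rewrite -tauM//; apply/O_divP => //; first exact: mulf_neq0.
rewrite bE invfM mulrACA divff// mul1r mulr_suml; apply: O_sum => j.
rewrite -[_ / _]mulrAC; apply: OM => //; rewrite -mulrA; exact: OM.
Qed.

(** Multiplying by [invmx U] isolates [diag a'], whose entry [(i, i)] is a sum to which the previous
    estimate applies. *)
Lemma GLO_diag_le (a a' : 'I_n.+1 -> K) c (U W : 'M_n.+1) :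
  (forall i, a i != 0) -> (forall i, a' i != 0) -> c != 0 -> GLO U -> GLO W ->
  U *m diag a' = c *: (diag a *m W) ->
  forall i, exists j, tau (a' i) <= tau c + tau (a j).
Proof.
move=> a0 a'0 c0 GU [OW _ _] E i; have [OV _ _] := GLO_inv GU.
apply: (le_tau_scaled_sum (u := fun j => invmx U i j)
  (w := fun j => W j i)) => //.
have : diag a' = c *: (invmx U *m (diag a *m W)).
  by rewrite scalemxAr -E mulKmx//; exact: GLO_unitmx.
move=> /matrixP/(_ i i); rewrite !mxE eqxx mulr1n => ->; congr (_ * _).
by apply: eq_bigr => j _; rewrite mul_diag_mx !mxE mulrA.
Qed.

Lemma diagV (a : 'I_n.+1 -> K) : (forall i, a i != 0) ->
  diag a *m diag (fun i => (a i)^-1) = 1%:M.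
Proof.
move=> a0; rewrite mulmx_diag; apply/matrixP => i j; rewrite !mxE divff//.
Qed.

(** Inverting both diagonal matrices gives a relation of the same shape with [U] and [W] exchanged;
    the upper bound for the inverses is the lower bound sought. *)
Lemma GLO_diag_ge (a a' : 'I_n.+1 -> K) c (U W : 'M_n.+1) :
  (forall i, a i != 0) -> (forall i, a' i != 0) -> c != 0 -> GLO U -> GLO W ->
  U *m diag a' = c *: (diag a *m W) ->
  forall i, exists j, tau c + tau (a j) <= tau (a' i).
Proof.
move=> a0 a'0 c0 GU GW E i.
have E' : W *m diag (fun i => (a' i)^-1) =
    c^-1 *: (diag (fun i => (a i)^-1) *m U).
  have /mulmx1C aV := diagV a0.
  rewrite -[U in RHS]mulmx1 -(diagV a'0) (mulmxA U) E -scalemxAl -scalemxAr.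
  by rewrite scalerA mulVf// scale1r !mulmxA aV mul1mx.
have aV0 j : (a j)^-1 != 0 by rewrite invr_eq0.
have a'V0 j : (a' j)^-1 != 0 by rewrite invr_eq0.
have cV0 : c^-1 != 0 by rewrite invr_eq0.
have [j] := GLO_diag_le aV0 a'V0 cV0 GW GU E' i.
by rewrite !tauV// -opprD lerN2; exists j.
Qed.

(** Two choices of lifts and bases differ by GL(O) and a scalar [t / z]. The scalar shifts every
    [tau] by the same amount and cancels in differences. By symmetry in [r] and [r'] the distance is
    unique. *)
Lemma is_FPdist_le (x y : FP v n) r r' :
  is_FPdist x y r -> is_FPdist x y r' -> r' <= r.
Proof.
move=> /is_FPdistP[L [M [B [a [[Lx My] [Bu a0] LB MB ->]]]]].
move=> /is_FPdistP[L' [M' [B' [a' [[Lx' My'] [Bu' a'0] LB' MB' ->]]]]].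
have /eqmodP/asboolP[z z0] : \pi_(FP v n) L = \pi_(FP v n) L' by rewrite Lx.
have /eqmodP/asboolP[t t0] : \pi_(FP v n) M = \pi_(FP v n) M' by rewrite My.
have Du : B *m diag a \in unitmx.
  by rewrite unitmx_mul Bu diag_unitmx; apply/forallP.
have Du' : B' *m diag a' \in unitmx.
  by rewrite unitmx_mul Bu' diag_unitmx; apply/forallP.
rewrite LB LB' MB MB' => /(homothety_mx Du Du' t0)[W GW DW].
move=> /(homothety_mx Bu Bu' z0)[U GU BU].
have E : U *m diag a' = (t / z) *: (diag a *m W).
  apply: (can_inj (mulKmx Bu)); rewrite -scalemxAr mulmxA.
  rewrite [t / z]mulrC -scalerA [B *m (_ *m W)]mulmxA -DW BU -scalemxAl.
  by rewrite scalerA mulVf// scale1r.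
have tz0 : t / z != 0 by rewrite mulf_neq0// invr_eq0.
apply: spread_le => i j.
have [k ik] := GLO_diag_le a0 a'0 tz0 GU GW E i.
have [l jl] := GLO_diag_ge a0 a'0 tz0 GU GW E j.
apply: le_trans (spread_ge a k l).
by apply: le_trans (lerB ik jl) _; rewrite opprD addrACA subrr add0r.
Qed.

Lemma FPdistE (x y : FP v n) r : is_FPdist x y r -> FPdist x y = r.
Proof.
move=> xyr; rewrite /FPdist; case: xgetP => [s _ xys|/(_ r)//].
by apply/eqP; rewrite eq_le (is_FPdist_le xys)// (is_FPdist_le xyr).
Qed.

(** * The displacement of a lattice class under [A] and its lower bound *)

Variables (A : 'M[K]_n.+1) (hA : A \in unitmx).

Lemma lat_act_span (L : lattice v n) (B : 'M_n.+1) :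
  (L : set V) = span (colf B) ->
  (lat_act hA L : set V) = span (colf (A *m B)).
Proof.
move=> LB; rewrite /= LB O_span_mul; congr (O_span v); apply: funext => j.
by rewrite /colf !colE mulmxA.
Qed.

Lemma is_FPdist_factor (L : lattice v n) (Q W : 'M_n.+1) (a : 'I_n.+1 -> K) :
  (L : set V) = span (colf Q) -> Q \in unitmx ->
  (forall i, a i != 0) -> GLO W ->
  A *m Q *m W = Q *m diag a ->
  is_FPdist (\pi_(FP v n) L) (FPact hA (\pi_(FP v n) L)) (spread a).
Proof.
move=> LQ Qu a0 GW AQ; apply/is_FPdistP; exists L, (lat_act hA L), Q, a.
split=> //; first by split=> //; rewrite FPactE.
by rewrite (lat_act_span LQ) -AQ (O_span_GLO _ GW).
Qed.

(** With the Smith form [U *m (invmx B *m A *m B) *m W = diag_mx d], the basis [B *m invmx U] of the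
    lattice is adapted to its image under [A]. *)
Lemma is_FPdist_ex (x : FP v n) : exists r, is_FPdist x (FPact hA x) r.
Proof.
elim/quotW: x => L.
have /asboolP/lattice_basis[B Bu LB] : `[< is_lattice v L >] by case: (L).
have [U [W [d [GU GW UMW]]]] := Smith_form (invmx B *m A *m B).
have Uu := GLO_unitmx GU; have Wu := GLO_unitmx GW.
have dE : diag_mx d = diag (d ord0).
  by congr diag_mx; apply/matrixP => i j; rewrite !mxE ord1.
exists (spread (d ord0)).
have QE : (L : set V) = span (colf (B *m invmx U)).
  by rewrite O_span_GLO//; exact: GLO_inv.
apply: (is_FPdist_factor QE _ _ (GLO_mul GU GW)).
- by rewrite unitmx_mul Bu unitmx_inv.
- apply/forallP; rewrite -diag_unitmx -dE -UMW.
  by rewrite !unitmx_mul unitmx_inv Bu hA Uu Wu.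
- rewrite -dE -UMW !mulmxA mulmxKV// -!mulmxA mulKmx// !mulmxA mulmxV//.
  by rewrite mul1mx.
Qed.

Lemma eigenvalue_le_spread (x : FP v n) r lam mu : is_FPdist x (FPact hA x) r ->
  eigenvalue A lam -> eigenvalue A mu -> tau lam - tau mu <= r.
Proof.
elim/quotW: x => L0 /is_FPdistP[L [L' [B [a [[LL0 LL'] [Bu a0] LB LD ->]]]]].
have /eqmodP/asboolP[z z0] : \pi_(FP v n) (lat_act hA L) = \pi_(FP v n) L'.
  by rewrite LL' -LL0 FPactE.
have ABu : A *m B \in unitmx by rewrite unitmx_mul hA.
have Du : B *m diag a \in unitmx.
  by rewrite unitmx_mul Bu diag_unitmx; apply/forallP.
rewrite LD (lat_act_span LB) => /(homothety_mx ABu Du z0)[W GW DW].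
(* [eigenvalue] provides a left eigenvector [y], and [u] is [y *m B]. The factor [z] appears because
   the lift [L'] is only homothetic to the image of [L]. *)
have eigP m : eigenvalue A m -> m != 0 /\ exists2 u : 'rV_n.+1, u != 0 &
    u *m diag a = (z * m) *: (u *m W).
  move=> /eigenvalueP[y yA y0]; split.
    apply: contra y0 => /eqP m0; rewrite m0 scale0r in yA.
    by rewrite -(mulmxK hA y) yA mul0mx.
  exists (y *m B).
    by apply: contra y0 => /eqP yB; rewrite -(mulmxK Bu y) yB mul0mx.
  by rewrite -mulmxA DW -scalemxAr !mulmxA yA -!scalemxAl scalerA.
have neq0 (u : 'rV[K]_n.+1) : u != 0 -> exists i, u 0 i != 0.
  by move=> u0; apply/rV0Pn.
have [OW _ _] := GW; have [OV _ _] := GLO_inv GW.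
move=> /eigP[lam0 [u u0 uE]] /eigP[mu0 [w w0 wE]].
(* Choose [i] with [u 0 i * a i] of maximal value and read coordinate [i] of
   [u *m diag a *m invmx W = (z * lam) *: u]. *)
have [i li] : exists i, tau z + tau lam <= tau (a i).
  have [|i ui Oi] := O_max (c := fun i => u 0 i * a i).
    by have [i ui] := neq0 _ u0; exists i; rewrite mulf_neq0.
  exists i; rewrite -tauM//; apply/O_divP => //; first exact: mulf_neq0.
  have ui0 : u 0 i != 0 by apply: contraNN ui => /eqP ->; rewrite mul0r.
  have : u *m diag a *m invmx W = (z * lam) *: u.
    by rewrite uE -scalemxAl mulmxK//; exact: GLO_unitmx.
  rewrite mul_mx_diag => /matrixP/(_ 0 i); rewrite !mxE => E.
  have -> : z * lam / a i = z * lam * u 0 i / (u 0 i * a i).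
    by rewrite invfM mulrA mulfK.
  by rewrite -E mulr_suml; apply: O_sum => j; rewrite !mxE mulrAC; apply: OM.
(* Choose [k] with [w 0 k] of maximal value and read coordinate [k] of [wE], divided by [w 0 k]. *)
have [j lj] : exists j, tau (a j) <= tau z + tau mu.
  have [|k wk Ok] := O_max (c := fun k => w 0 k); first exact: neq0.
  exists k; rewrite -tauM//; apply/O_divP => //; first exact: mulf_neq0.
  move/matrixP/(_ 0 k): wE; rewrite mul_mx_diag !mxE => E.
  have -> : a k / (z * mu) = z * mu * (\sum_j w 0 j * W j k) / w 0 k / (z * mu).
    by rewrite -E [w 0 k * _]mulrC mulfK.
  rewrite mulrAC [z * mu * _]mulrC mulfK; last exact: mulf_neq0.
  by rewrite mulr_suml; apply: O_sum => j; rewrite mulrAC; apply: OM.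
apply: le_trans (spread_ge a i j); apply: le_trans (lerB li lj).
by rewrite opprD addrACA subrr add0r.
Qed.

(** * Attaining the bound on a rescaled triangularising basis *)

Lemma O_scale_seq (s : seq K) :
  exists t : K, [/\ t != 0, O t & forall z, z \in s -> O (t * z)].
Proof.
elim: s => [|z s [t [t0 Ot ts]]].
  by exists 1; split; [exact: oner_neq0|exact: O1|].
(* Clearing the single element [z] is enough: both scalars lie in [O], so their product still clears
   all the others. *)
suff [u [u0 Ou uz]] : exists u : K, [/\ u != 0, O u & O (u * z)].
  exists (u * t); split; [exact: mulf_neq0|exact: OM|move=> w].
  rewrite inE => /predU1P[->|/ts ws]; first by rewrite mulrAC; exact: OM.
  by rewrite -mulrA; exact: OM.
have [->|z0] := eqVneq z 0.
  by exists 1; rewrite mulr0; split; [exact: oner_neq0|exact: O1|exact: O0].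
have [z1|z1] := leP (tau z) 0.
  by exists 1; rewrite mul1r; split; [exact: oner_neq0|exact: O1|right].
exists z^-1; rewrite invr_eq0 mulVf//; split => //; last exact: O1.
by right; rewrite tauV// oppr_le0 ltW.
Qed.

Lemma trig_form : exists (P T : 'M[K]_n.+1),
  [/\ P \in unitmx, is_trig_mx T & A *m P = P *m T].
Proof.
have [P /unitarymx_unit Pu PT] := Schur A (ltn0Sn n).
exists (invmx P), (P *m A *m invmx P); split; first by rewrite unitmx_inv.
  by rewrite -conjumx.
by rewrite !mulmxA mulVmx// mul1mx.
Qed.

(** In the basis [P *m S] the matrix of [A] is the diagonal of [T] times a unitriangular [W] over
    [O], so the displacement is the spread of that diagonal, made of eigenvalues of [A]. *)
Lemma is_FPdist_eigenvalues : exists (x : FP v n) (a : 'I_n.+1 -> K),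
  [/\ forall i, a i != 0, forall i, eigenvalue A (a i) &
      is_FPdist x (FPact hA x) (spread a)].
Proof.
have [P [T [Pu Ttrig AP]]] := trig_form.
have TE : T = invmx P *m A *m P by rewrite -mulmxA AP mulKmx.
have T0 i : T i i != 0.
  have : T \in unitmx by rewrite TE !unitmx_mul unitmx_inv Pu hA.
  by rewrite unitmxE unitfE det_trig// => /prodf_neq0; apply.
(* Conjugating by diag (t ^- i) multiplies the entry (i, j) by t ^ (i - j). *)
have [t [t0 Ot tT]] :=
  O_scale_seq [seq T p.1 p.2 / T p.1 p.1 | p : 'I_n.+1 * 'I_n.+1].
pose S := diag_mx (\row_i t ^- i : 'rV[K]_n.+1).
(* Each row is divided by its diagonal entry, which makes the diagonal of [W] equal to 1. *)
pose W : 'M_n.+1 := \matrix_(i, j) (t ^+ i * (T i j / T i i) * t ^- j).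
have Wtrig : is_trig_mx W.
  apply/is_trig_mxP => i j ij.
  by rewrite mxE (is_trig_mxP Ttrig)// mul0r mulr0 mul0r.
have GW : GLO W.
  apply: GLO_det1; last first.
    rewrite det_trig// big1// => i _.
    by rewrite mxE divff// mulr1 divff// expf_neq0.
  move=> i j; rewrite mxE; have [ij|ij|ij] := ltngtP i j.
  - by rewrite (is_trig_mxP Ttrig)// mul0r mulr0 mul0r; exact: O0.
  (* Below the diagonal the exponent [i - j] is at least 1: one factor [t] brings [T i j / T i i]
     into [O], and the remaining power of [t] is in [O]. *)
  - rewrite mulrAC -expfB// -(subnSK ij) exprSr -mulrA; apply: OM.
      by elim: (_ - _)%N => [|m IH]; [exact: O1|rewrite exprS; exact: OM].
    apply: tT.
    exact: (codom_f (fun p : _ * _ => T p.1 p.2 / T p.1 p.1) (i, j)).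
  - rewrite (ord_inj ij) divff// mulr1 divff ?expf_neq0//; exact: O1.
have Su : S \in unitmx.
  by rewrite diag_unitmx; apply/forallP => i; rewrite invr_eq0 expf_neq0.
have Qu : P *m S \in unitmx by rewrite unitmx_mul Pu.
pose L := Lattice (asboolT (is_lattice_span Qu)).
exists (\pi_(FP v n) L), (fun i => T i i); split => //.
  (* A left eigenvector [y] of [T] becomes the left eigenvector [y *m invmx P] of [A]. *)
  move=> i; have : eigenvalue T (T i i).
    rewrite eigenvalue_root_char char_poly_trig// (bigD1 i)//= rootM.
    by rewrite root_XsubC eqxx.
  have Pu' : invmx P \in unitmx by rewrite unitmx_inv.
  move=> /eigenvalueP[y yT y0]; apply/eigenvalueP; exists (y *m invmx P).
    by rewrite scalemxAl -yT TE -!mulmxA mulmxV// mulmx1.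
  by apply: contra y0 => /eqP yP; rewrite -(mulmxK Pu' y) yP mul0mx.
apply: (@is_FPdist_factor L (P *m S) (invmx W)) => //; first exact: GLO_inv.
apply: (can_inj (mulmxK (GLO_unitmx GW))).
rewrite mulmxKV ?(GLO_unitmx GW)// mulmxA AP -!mulmxA; congr (_ *m _).
apply/matrixP => i j; rewrite mul_mx_diag !mul_diag_mx !mxE.
rewrite -(mulrA (t ^+ i)) (mulrCA (T i i)) mulKf ?expf_neq0//.
by rewrite mulrA [T i i * _]mulrC divfK.
Qed.

End Lattice.
End Valuation.

(** * The translation length computed from the eigenvalues *)

Theorem proposition6p2 (R : realType) (F : rcfType) (iota : {rmorphism R -> F})
  (hnonarch : ~ Num.archimedean_axiom F) (hrank : finite_rank F)
  (v : F -> R) (hv : real_valuation v) (hsurj : surjective_valuation v)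
  (hconv : convex_valuation v)
  (n : nat) (A : 'M[F[i]]_n.+1) (hA : A \in unitmx)
  (lam : n.+1.-tuple F[i])
  (hlam : char_poly A = \prod_(z <- lam) ('X - z%:P))
  (hord : forall i j : 'I_n.+1, (i <= j)%N ->
     cabs (tnth lam j) <= cabs (tnth lam i)) :
  (exists x : FP v n, FPdist x (FPact hA x) = transl_length v hA) /\
  transl_length v hA =
    tau v (cabs (tnth lam ord0 / tnth lam ord_max))%:C.

Proof.
have lamE z : eigenvalue A z = (z \in (lam : seq F[i])).
  by rewrite eigenvalue_root_char hlam root_prod_XsubC.
have lam_eig i : eigenvalue A (tnth lam i) by rewrite lamE mem_tnth.
have lam0 i : tnth lam i != 0.
  apply/eqP => i0; have := lam_eig i; rewrite i0 => /eigenvalueP[y yA].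
  by rewrite -(mulmxK hA y) yA scale0r mul0mx eqxx.
pose l := tau v (tnth lam ord0) - tau v (tnth lam ord_max).
have -> : tau v (cabs (tnth lam ord0 / tnth lam ord_max))%:C = l.
  (* [tau] depends only on the modulus, and the modulus of an embedded nonnegative element of [F] is
     that element. *)
  have -> : tau v (cabs (tnth lam ord0 / tnth lam ord_max))%:C =
      tau v (tnth lam ord0 / tnth lam ord_max).
    rewrite /tau /ext_val; congr (- v _).
    rewrite /= expr0n addr0 sqrtr_sqr ger0_norm//.
    by case: (_ / _) => p q; exact: sqrtr_ge0.
  by rewrite tauM ?invr_eq0// tauV.
have lb (x : FP v n) : l <= FPdist x (FPact hA x).
  have [r xr] := is_FPdist_ex hv hconv hA x; rewrite (FPdistE hv hconv xr).
  exact: eigenvalue_le_spread xr _ _.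
have [x [a [a0 a_eig xa]]] := is_FPdist_eigenvalues hv hconv hA.
have xl : FPdist x (FPact hA x) = l.
  apply/eqP; rewrite eq_le lb andbT (FPdistE hv hconv xa).
  (* Every [a i] is some [tnth lam k], so the ordering places its [tau] between those of the last
     and the first eigenvalue. *)
  apply: spread_le => i j; apply: lerB.
    have /tnthP[k ->] : a i \in lam by rewrite -lamE.
    apply: (le_tau hv hconv); first exact: lam0.
    exact: hord.
  have /tnthP[k ->] : a j \in lam by rewrite -lamE.
  apply: (le_tau hv hconv); first exact: lam0.
  by apply: hord; rewrite -ltnS ltn_ord.
(* [l] is a lower bound of the displacements and is attained at [x], so the set is nonempty and
   bounded below and its infimum is [l]. *)
have tl : transl_length v hA = l.
  apply/eqP; rewrite eq_le; apply/andP; split.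
    by rewrite -xl; apply: ge_inf; [exists l => _ [y _ <-]|exists x].
  apply: lb_le_inf; first by exists l, x.
  by move=> _ [y _ <-].
by split=> //; exists x; rewrite xl tl.
Qed.
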